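(* Let $A$ be an algebra in a monoidal category $(\mathcal{C},\otimes,1)$. Then the following assertions are equivalent: (i) the unit $u_A:1\to A$ is regular (resp., split-mono, split-epi) as a morphism in $\mathcal{C}$; (ii) the tensor functor $-\otimes A:\mathcal{C}\to\mathcal{C}_A$ is semiseparable (resp., separable, naturally full); (iii) the tensor functor $A\otimes-:\mathcal{C}\to{}_A\mathcal{C}$ is semiseparable (resp., separable, naturally full).
   Context: Here $\mathcal{C}_A$ (resp. ${}_A\mathcal{C}$) is the category of right (resp. left) modules over the algebra $(A,m_A,u_A)$ in $\mathcal{C}$; the functor $-\otimes A$ sends $M$ to $M\otimes A$ with right $A$-action $\mathrm{Id}_M\otimes m_A$, and $A\otimes-$ sends $M$ to $A\otimes M$ with left $A$-action $m_A\otimes\mathrm{Id}_M$ (associativity and unit constraints suppressed). A morphism $f$ is regular if there is a morphism $g$ with $f\circ g\circ f=f$; split-mono if it has a left inverse; split-epi if it has a right inverse. A functor $F:\mathcal{A}\to\mathcal{B}$ induces the natural transformation $\mathcal{F}:\mathrm{Hom}_{\mathcal{A}}(-,-)\to\mathrm{Hom}_{\mathcal{B}}(F-,F-)$, $f\mapsto F(f)$. $F$ is separable (resp. naturally full, semiseparable) if there is a natural transformation $\mathcal{P}:\mathrm{Hom}_{\mathcal{B}}(F-,F-)\to\mathrm{Hom}_{\mathcal{A}}(-,-)$ with $\mathcal{P}\circ\mathcal{F}=\mathrm{Id}$ (resp. $\mathcal{F}\circ\mathcal{P}=\mathrm{Id}$, $\mathcal{F}\circ\mathcal{P}\circ\mathcal{F}=\mathcal{F}$).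 The three versions (semiseparable with regular, separable with split-mono, naturally full with split-epi) are three separate equivalences. *)

(* Defs.v *)
From Stdlib Require Import ssreflect ProofIrrelevance.

Set Implicit Arguments.
Unset Strict Implicit.
Unset Printing Implicit Defensive.

Declare Scope cat_scope.
Delimit Scope cat_scope with cat.
Local Open Scope cat_scope.

Record category := Category {
  obj :> Type;
  hom : obj -> obj -> Type;
  idc : forall X : obj, hom X X;
  comp : forall X Y Z : obj, hom Y Z -> hom X Y -> hom X Z;
  comp1c : forall (X Y : obj) (f : hom X Y), comp (idc Y) f = f;
  compc1 : forall (X Y : obj) (f : hom X Y), comp f (idc X) = f;
  compA : forall (X Y Z W : obj) (h : hom Z W) (g : hom Y Z) (f : hom X Y),
    comp h (comp g f) = comp (comp h g) f
}.

Arguments hom {c} X Y.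
Arguments idc {c} X.
Arguments comp {c X Y Z} g f.
Arguments comp1c {c X Y} f.
Arguments compc1 {c X Y} f.
Arguments compA {c X Y Z W} h g f.

Notation "g ∘ f" := (comp g f) (at level 40, left associativity) : cat_scope.

Record functor (C D : category) := Functor {
  fobj :> C -> D;
  fmap : forall X Y : C, hom X Y -> hom (fobj X) (fobj Y);
  fmap_id : forall X : C, fmap (idc X) = idc (fobj X);
  fmap_comp : forall (X Y Z : C) (g : hom Y Z) (f : hom X Y),
    fmap (g ∘ f) = fmap g ∘ fmap f
}.

Arguments fmap {C D} F {X Y} f : rename.

Definition regular_mor (C : category) (X Y : C) (f : hom X Y) : Prop :=
  exists g : hom Y X, f ∘ g ∘ f = f.

Definition split_mono (C : category) (X Y : C) (f : hom X Y) : Prop :=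
  exists g : hom Y X, g ∘ f = idc X.

Definition split_epi (C : category) (X Y : C) (f : hom X Y) : Prop :=
  exists g : hom Y X, f ∘ g = idc Y.

(* Naturality in both variables of a family Hom_D(F-, F-) -> Hom_C(-, -),
   regarded as a transformation of functors on C^op x C. *)
Definition hom_natural (C D : category) (F : functor C D)
    (P : forall X Y : C, hom (F X) (F Y) -> hom X Y) : Prop :=
  forall (X X' Y Y' : C) (h : hom X' X) (k : hom Y Y') (g : hom (F X) (F Y)),
    P X' Y' (fmap F k ∘ g ∘ fmap F h) = k ∘ P X Y g ∘ h.

Definition separable (C D : category) (F : functor C D) : Prop :=
  exists P : forall X Y : C, hom (F X) (F Y) -> hom X Y,
    hom_natural P /\
    forall (X Y : C) (f : hom X Y), P X Y (fmap F f) = f.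

Definition naturally_full (C D : category) (F : functor C D) : Prop :=
  exists P : forall X Y : C, hom (F X) (F Y) -> hom X Y,
    hom_natural P /\
    forall (X Y : C) (g : hom (F X) (F Y)), fmap F (P X Y g) = g.

Definition semiseparable (C D : category) (F : functor C D) : Prop :=
  exists P : forall X Y : C, hom (F X) (F Y) -> hom X Y,
    hom_natural P /\
    forall (X Y : C) (f : hom X Y), fmap F (P X Y (fmap F f)) = fmap F f.

Record moncat := Moncat {
  mcat :> category;
  munit : mcat;
  tens : mcat -> mcat -> mcat;
  tmap : forall X X' Y Y' : mcat,
    hom X X' -> hom Y Y' -> hom (tens X Y) (tens X' Y');
  tmap_id : forall X Y : mcat, tmap (idc X) (idc Y) = idc (tens X Y);
  tmap_comp : forall (X X' X'' Y Y' Y'' : mcat)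
    (f' : hom X' X'') (f : hom X X') (g' : hom Y' Y'') (g : hom Y Y'),
    tmap (f' ∘ f) (g' ∘ g) = tmap f' g' ∘ tmap f g;
  assoc : forall X Y Z : mcat, hom (tens (tens X Y) Z) (tens X (tens Y Z));
  associ : forall X Y Z : mcat, hom (tens X (tens Y Z)) (tens (tens X Y) Z);
  assocK : forall X Y Z : mcat, associ X Y Z ∘ assoc X Y Z = idc _;
  associK : forall X Y Z : mcat, assoc X Y Z ∘ associ X Y Z = idc _;
  assoc_nat : forall (X X' Y Y' Z Z' : mcat)
    (f : hom X X') (g : hom Y Y') (h : hom Z Z'),
    assoc X' Y' Z' ∘ tmap (tmap f g) h = tmap f (tmap g h) ∘ assoc X Y Z;
  lunit : forall X : mcat, hom (tens munit X) X;
  luniti : forall X : mcat, hom X (tens munit X);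
  lunitK : forall X : mcat, luniti X ∘ lunit X = idc _;
  lunitiK : forall X : mcat, lunit X ∘ luniti X = idc _;
  lunit_nat : forall (X X' : mcat) (f : hom X X'),
    lunit X' ∘ tmap (idc munit) f = f ∘ lunit X;
  runit : forall X : mcat, hom (tens X munit) X;
  runiti : forall X : mcat, hom X (tens X munit);
  runitK : forall X : mcat, runiti X ∘ runit X = idc _;
  runitiK : forall X : mcat, runit X ∘ runiti X = idc _;
  runit_nat : forall (X X' : mcat) (f : hom X X'),
    runit X' ∘ tmap f (idc munit) = f ∘ runit X;
  pentagon : forall X Y Z W : mcat,
    tmap (idc X) (assoc Y Z W) ∘ assoc X (tens Y Z) W
      ∘ tmap (assoc X Y Z) (idc W)
    = assoc X Y (tens Z W) ∘ assoc (tens X Y) Z W;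
  triangle : forall X Y : mcat,
    tmap (idc X) (lunit Y) ∘ assoc X munit Y = tmap (runit X) (idc Y)
}.

Arguments munit {m}.
Arguments tens {m} X Y.
Arguments tmap {m X X' Y Y'} f g.
Arguments tmap_id {m} X Y.
Arguments tmap_comp {m X X' X'' Y Y' Y''} f' f g' g.
Arguments assoc {m} X Y Z.
Arguments associ {m} X Y Z.
Arguments assocK {m} X Y Z.
Arguments associK {m} X Y Z.
Arguments assoc_nat {m X X' Y Y' Z Z'} f g h.
Arguments lunit {m} X.
Arguments luniti {m} X.
Arguments lunitK {m} X.
Arguments lunitiK {m} X.
Arguments lunit_nat {m X X'} f.
Arguments runit {m} X.
Arguments runiti {m} X.
Arguments runitK {m} X.
Arguments runitiK {m} X.
Arguments runit_nat {m X X'} f.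
Arguments pentagon {m} X Y Z W.
Arguments triangle {m} X Y.

Notation "X ⊗ Y" := (tens X Y) (at level 35, right associativity) : cat_scope.
Notation "f ⊠ g" := (tmap f g) (at level 35, no associativity) : cat_scope.

Section Coherence.
Variable C : moncat.
Implicit Types X Y Z : C.

Lemma tmap_compl X X' X'' Y (f' : hom X' X'') (f : hom X X') :
  (f' ∘ f) ⊠ idc Y = (f' ⊠ idc Y) ∘ (f ⊠ idc Y).
Proof. by rewrite -tmap_comp comp1c. Qed.

Lemma tmap_compr X Y Y' Y'' (g' : hom Y' Y'') (g : hom Y Y') :
  idc X ⊠ (g' ∘ g) = (idc X ⊠ g') ∘ (idc X ⊠ g).
Proof. by rewrite -tmap_comp comp1c. Qed.

Lemma tmap_lr X X' Y Y' (f : hom X X') (g : hom Y Y') :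
  (f ⊠ idc Y') ∘ (idc X ⊠ g) = f ⊠ g.
Proof. by rewrite -tmap_comp compc1 comp1c. Qed.

Lemma tmap_rl X X' Y Y' (f : hom X X') (g : hom Y Y') :
  (idc X' ⊠ g) ∘ (f ⊠ idc Y) = f ⊠ g.
Proof. by rewrite -tmap_comp compc1 comp1c. Qed.

Lemma associ_nat X X' Y Y' Z Z' (f : hom X X') (g : hom Y Y') (h : hom Z Z') :
  associ X' Y' Z' ∘ (f ⊠ (g ⊠ h)) = ((f ⊠ g) ⊠ h) ∘ associ X Y Z.
Proof.
rewrite -[LHS]compc1 -(associK X Y Z) compA -(compA (associ _ _ _)) -assoc_nat.
by rewrite compA assocK comp1c.
Qed.

Lemma tmapr_inj X Y (f g : hom X Y) :
  f ⊠ idc (munit (m := C)) = g ⊠ idc munit -> f = g.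
Proof.
move=> e; rewrite -(compc1 f) -(compc1 g) -(runitiK X) !compA.
by rewrite -!runit_nat e.
Qed.

Lemma tmapl_inj X Y (f g : hom X Y) :
  idc (munit (m := C)) ⊠ f = idc munit ⊠ g -> f = g.
Proof.
move=> e; rewrite -(compc1 f) -(compc1 g) -(lunitiK X) !compA.
by rewrite -!lunit_nat e.
Qed.

(* Kelly's unit coherences, consequences of the pentagon and the triangle. *)
Lemma runit_tens X Y : (idc X ⊠ runit Y) ∘ assoc X Y munit = runit (X ⊗ Y).
Proof.
apply: tmapr_inj.
rewrite -[LHS]comp1c -[RHS]comp1c -(assocK X Y munit) -!compA; congr (_ ∘ _).
rewrite tmap_compl compA assoc_nat -!triangle tmap_compr -!compA.
rewrite (compA (idc X ⊠ assoc _ _ _)) pentagon !compA; congr (_ ∘ _).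
by rewrite -assoc_nat tmap_id.
Qed.

Lemma lunit_tens X Y : lunit (X ⊗ Y) ∘ assoc munit X Y = lunit X ⊠ idc Y.
Proof.
apply: tmapl_inj.
have E : (idc munit ⊠ (lunit (X ⊗ Y) ∘ assoc munit X Y))
    ∘ assoc munit (munit ⊗ X) Y ∘ (assoc munit munit X ⊠ idc Y)
  = (idc munit ⊠ (lunit X ⊠ idc Y))
    ∘ assoc munit (munit ⊗ X) Y ∘ (assoc munit munit X ⊠ idc Y).
  rewrite tmap_compr -!compA (compA (_ ⊠ assoc _ _ _)) pentagon !compA triangle.
  rewrite -assoc_nat -[in RHS]compA -tmap_compl triangle assoc_nat.
  by rewrite tmap_id.
have := f_equal (fun k => k ∘ (associ munit munit X ⊠ idc Y)
                  ∘ associ munit (munit ⊗ X) Y) E.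
by rewrite -!compA !(compA (assoc _ _ _ ⊠ _)) -!tmap_compl !associK
  !tmap_id !comp1c !associK !compc1.
Qed.

End Coherence.

Record algebra (C : moncat) := Algebra {
  alg :> C;
  amul : hom (alg ⊗ alg) alg;
  aunit : hom munit alg;
  amulA : amul ∘ (amul ⊠ idc alg)
    = amul ∘ (idc alg ⊠ amul) ∘ assoc alg alg alg;
  amul1l : amul ∘ (aunit ⊠ idc alg) = lunit alg;
  amul1r : amul ∘ (idc alg ⊠ aunit) = runit alg
}.

Arguments amul {C} a.
Arguments aunit {C} a.
Arguments amulA {C} a.
Arguments amul1l {C} a.
Arguments amul1r {C} a.

Section Modules.
Variables (C : moncat) (A : algebra C).

Record rmodule := RModule {
  rmod :> C;
  ract : hom (rmod ⊗ A) rmod;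
  ractA : ract ∘ (ract ⊠ idc A)
    = ract ∘ (idc rmod ⊠ amul A) ∘ assoc rmod A A;
  ract1 : ract ∘ (idc rmod ⊠ aunit A) = runit rmod
}.

Record lmodule := LModule {
  lmod :> C;
  lact : hom (A ⊗ lmod) lmod;
  lactA : lact ∘ (amul A ⊠ idc lmod)
    = lact ∘ (idc A ⊠ lact) ∘ assoc A A lmod;
  lact1 : lact ∘ (aunit A ⊠ idc lmod) = lunit lmod
}.

Record rhom (M N : rmodule) := RHom {
  rhom_val :> hom (rmod M) (rmod N);
  rhomP : rhom_val ∘ ract M = ract N ∘ (rhom_val ⊠ idc A)
}.

Record lhom (M N : lmodule) := LHom {
  lhom_val :> hom (lmod M) (lmod N);
  lhomP : lhom_val ∘ lact M = lact N ∘ (idc A ⊠ lhom_val)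
}.

Lemma rhom_eq (M N : rmodule) (f g : rhom M N) :
  rhom_val f = rhom_val g -> f = g.
Proof.
case: f g => [f Hf] [g Hg] /= e; subst g.
by rewrite (proof_irrelevance _ Hf Hg).
Qed.

Lemma lhom_eq (M N : lmodule) (f g : lhom M N) :
  lhom_val f = lhom_val g -> f = g.
Proof.
case: f g => [f Hf] [g Hg] /= e; subst g.
by rewrite (proof_irrelevance _ Hf Hg).
Qed.

Lemma rhom_id_subproof (M : rmodule) :
  idc (rmod M) ∘ ract M = ract M ∘ (idc (rmod M) ⊠ idc A).
Proof. by rewrite tmap_id comp1c compc1. Qed.

Lemma rhom_comp_subproof (M N K : rmodule) (g : rhom N K) (f : rhom M N) :
  (g ∘ f) ∘ ract M = ract K ∘ ((g ∘ f) ⊠ idc A).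
Proof. by rewrite tmap_compl compA -rhomP -!compA rhomP. Qed.

Lemma lhom_id_subproof (M : lmodule) :
  idc (lmod M) ∘ lact M = lact M ∘ (idc A ⊠ idc (lmod M)).
Proof. by rewrite tmap_id comp1c compc1. Qed.

Lemma lhom_comp_subproof (M N K : lmodule) (g : lhom N K) (f : lhom M N) :
  (g ∘ f) ∘ lact M = lact K ∘ (idc A ⊠ (g ∘ f)).
Proof. by rewrite tmap_compr compA -lhomP -!compA lhomP. Qed.

Definition rhom_id (M : rmodule) : rhom M M := RHom (rhom_id_subproof M).
Definition rhom_comp (M N K : rmodule) (g : rhom N K) (f : rhom M N) :
  rhom M K := RHom (rhom_comp_subproof g f).
Definition lhom_id (M : lmodule) : lhom M M := LHom (lhom_id_subproof M).
Definition lhom_comp (M N K : lmodule) (g : lhom N K) (f : lhom M N) :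
  lhom M K := LHom (lhom_comp_subproof g f).

Definition rmod_cat : category.
Proof.
refine (@Category rmodule rhom rhom_id rhom_comp _ _ _).
- by move=> M N f; apply: rhom_eq; apply: comp1c.
- by move=> M N f; apply: rhom_eq; apply: compc1.
- by move=> M N K L h g f; apply: rhom_eq; apply: compA.
Defined.

Definition lmod_cat : category.
Proof.
refine (@Category lmodule lhom lhom_id lhom_comp _ _ _).
- by move=> M N f; apply: lhom_eq; apply: comp1c.
- by move=> M N f; apply: lhom_eq; apply: compc1.
- by move=> M N K L h g f; apply: lhom_eq; apply: compA.
Defined.

Definition free_ract (M : C) : hom ((M ⊗ A) ⊗ A) (M ⊗ A) :=
  (idc M ⊠ amul A) ∘ assoc M A A.

Definition free_lact (M : C) : hom (A ⊗ (A ⊗ M)) (A ⊗ M) :=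
  (amul A ⊠ idc M) ∘ associ A A M.

Lemma free_ractA (M : C) :
  free_ract M ∘ (free_ract M ⊠ idc A)
  = free_ract M ∘ (idc (M ⊗ A) ⊠ amul A) ∘ assoc (M ⊗ A) A A.
Proof.
rewrite /free_ract tmap_compl -!compA.
rewrite (compA (assoc M A A) (_ ⊠ _)) assoc_nat.
rewrite (compA (assoc M A A) (_ ⊠ amul A)) -tmap_id assoc_nat.
rewrite -(compA _ (assoc M A _) (assoc _ _ _)) -pentagon !compA -!tmap_compr.
by rewrite amulA.
Qed.

Lemma free_ract1 (M : C) :
  free_ract M ∘ (idc (M ⊗ A) ⊠ aunit A) = runit (M ⊗ A).
Proof.
rewrite /free_ract -compA -tmap_id assoc_nat compA -tmap_compr amul1r.
exact: runit_tens.
Qed.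

Lemma free_lactA (M : C) :
  free_lact M ∘ (amul A ⊠ idc (A ⊗ M))
  = free_lact M ∘ (idc A ⊠ free_lact M) ∘ assoc A A (A ⊗ M).
Proof.
have E : (idc A ⊠ associ A A M) ∘ assoc A A (A ⊗ M)
    = assoc A (A ⊗ A) M ∘ (assoc A A A ⊠ idc M) ∘ associ (A ⊗ A) A M.
  rewrite -[LHS]compc1 -(associK (A ⊗ A) A M) !compA.
  rewrite -(compA _ (assoc A A (A ⊗ M))) -pentagon !compA -tmap_compr assocK.
  by rewrite tmap_id comp1c.
rewrite /free_lact tmap_compr -!compA E !compA.
rewrite -(compA _ (associ A A M) (idc A ⊠ _)) associ_nat !compA.
rewrite -(compA _ (associ A (A ⊗ A) M)) assocK compc1 -!tmap_compl -amulA.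
by rewrite -compA -tmap_id associ_nat compA -tmap_compl.
Qed.

Lemma free_lact1 (M : C) :
  free_lact M ∘ (aunit A ⊠ idc (A ⊗ M)) = lunit (A ⊗ M).
Proof.
rewrite /free_lact -compA -tmap_id associ_nat compA -tmap_compl amul1l.
by rewrite -lunit_tens -compA associK compc1.
Qed.

Definition free_rmod (M : C) : rmod_cat :=
  RModule (free_ractA M) (free_ract1 M).

Definition free_lmod (M : C) : lmod_cat :=
  LModule (free_lactA M) (free_lact1 M).

Lemma free_rhomP (M N : C) (f : hom M N) :
  (f ⊠ idc A) ∘ free_ract M = free_ract N ∘ ((f ⊠ idc A) ⊠ idc A).
Proof.
rewrite /free_ract -compA assoc_nat !compA tmap_id.
by rewrite tmap_lr tmap_rl.
Qed.

Lemma free_lhomP (M N : C) (f : hom M N) :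
  (idc A ⊠ f) ∘ free_lact M = free_lact N ∘ (idc A ⊠ (idc A ⊠ f)).
Proof.
rewrite /free_lact -compA associ_nat !compA tmap_id.
by rewrite tmap_lr tmap_rl.
Qed.

Definition free_rhom (M N : C) (f : hom M N) :
    hom (free_rmod M) (free_rmod N) :=
  @RHom (free_rmod M) (free_rmod N) (f ⊠ idc A) (free_rhomP f).

Definition free_lhom (M N : C) (f : hom M N) :
    hom (free_lmod M) (free_lmod N) :=
  @LHom (free_lmod M) (free_lmod N) (idc A ⊠ f) (free_lhomP f).

Definition rtensor : functor C rmod_cat.
Proof.
refine (@Functor C rmod_cat free_rmod free_rhom _ _).
- by move=> X; apply: rhom_eq; apply: tmap_id.
- by move=> X Y Z g f; apply: rhom_eq; apply: tmap_compl.
Defined.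

Definition ltensor : functor C lmod_cat.
Proof.
refine (@Functor C lmod_cat free_lmod free_lhom _ _).
- by move=> X; apply: lhom_eq; apply: tmap_id.
- by move=> X Y Z g f; apply: lhom_eq; apply: tmap_compr.
Defined.

End Modules.

(* Main.v *)
(** Both tensor functors [F] are left adjoint to the forgetful functor [U], with
    unit [eta_X = X ⊗ u] up to unitors. As in Rafael's theorem, [F] is
    semiseparable (separable, naturally full) iff there is a natural
    [nu : U F -> Id] with [eta nu eta = eta] ([nu eta = 1], [eta nu = 1]): take
    [P h = nu ∘ U h ∘ eta] and conversely [nu_X = P (eps_(F X))]. A one-sided
    or generalized inverse [g : A -> 1] of [u] gives [nu_X = X ⊗ g]; conversely [eta_1] is [u] up
    to isomorphisms, so [nu_1] gives [g]. *)

From Stdlib Require Import ssreflect.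
Require Import Defs.

Set Implicit Arguments.
Unset Strict Implicit.
Unset Printing Implicit Defensive.

Local Open Scope cat_scope.

(** * Rafael-type criteria for a left adjoint in terms of the unit *)

Record adjunction (C D : category) (F : functor C D) (U : functor D C) :=
  Adjunction {
  eta : forall X : C, hom X (U (F X));
  eps : forall M : D, hom (F (U M)) M;
  eta_nat : forall (X Y : C) (f : hom X Y),
    fmap U (fmap F f) ∘ eta X = eta Y ∘ f;
  eps_nat : forall (M N : D) (h : hom M N),
    h ∘ eps M = eps N ∘ fmap F (fmap U h);
  fmap_eps_eta : forall M : D, fmap U (eps M) ∘ eta (U M) = idc (U M);
  eps_fmap_eta : forall X : C, eps (F X) ∘ fmap F (eta X) = idc (F X)
}.

Arguments eta {C D F U} a X.
Arguments eps {C D F U} a M.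
Arguments eta_nat {C D F U} a {X Y} f.
Arguments eps_nat {C D F U} a {M N} h.
Arguments fmap_eps_eta {C D F U} a M.
Arguments eps_fmap_eta {C D F U} a X.

Section Rafael.
Variables (C D : category) (F : functor C D) (U : functor D C).
Variable adj : adjunction F U.

Local Notation η := (eta adj).
Local Notation ε := (eps adj).

(** Any [l] out of [F X] is recovered from its transpose as [ε M ∘ fmap F (fmap U l ∘ η X)], by
    naturality of the counit and a triangle identity. *)
Lemma adj_inj (X : C) (M : D) (h k : hom (F X) M) :
  fmap U h ∘ η X = fmap U k ∘ η X -> h = k.
Proof.
have E (l : hom (F X) M) : l = ε M ∘ fmap F (fmap U l ∘ η X).
  by rewrite fmap_comp compA -eps_nat -compA eps_fmap_eta compc1.
by move=> e; rewrite (E h) (E k) e.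
Qed.

(** Only naturality of [nu : U F -> Id]; each criterion below adds its own equation between [nu] and
    the unit. *)
Definition retraction_natural (nu : forall X : C, hom (U (F X)) X) : Prop :=
  forall (X Y : C) (f : hom X Y), f ∘ nu X = nu Y ∘ fmap U (fmap F f).

Definition hom_of_nu (nu : forall X : C, hom (U (F X)) X) (X Y : C)
  (h : hom (F X) (F Y)) : hom X Y := nu Y ∘ fmap U h ∘ η X.

Definition nu_of_hom (P : forall X Y : C, hom (F X) (F Y) -> hom X Y) (X : C) :
  hom (U (F X)) X := P (U (F X)) X (ε (F X)).

Lemma hom_of_nu_natural nu : retraction_natural nu -> hom_natural (hom_of_nu nu).
Proof.
move=> N X X' Y Y' h k g; rewrite /hom_of_nu !fmap_comp !compA -N -!compA.
by rewrite eta_nat.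
Qed.

Lemma hom_of_nu_fmap nu (X Y : C) (f : hom X Y) :
  hom_of_nu nu (fmap F f) = nu Y ∘ η Y ∘ f.
Proof. by rewrite /hom_of_nu -compA eta_nat compA. Qed.

(** Both sides equal [P] of [fmap F f ∘ ε (F X)]: one by naturality of [P] in the target, the other
    by naturality in the source and of the counit. *)
Lemma nu_of_hom_natural P : hom_natural P -> retraction_natural (nu_of_hom P).
Proof.
move=> N X Y f; rewrite /nu_of_hom.
have := N _ _ _ _ (idc _) f (ε (F X)); rewrite fmap_id !compc1 => <-.
have := N _ _ _ _ (fmap U (fmap F f)) (idc _) (ε (F Y)).
by rewrite fmap_id !comp1c eps_nat.
Qed.

(** Naturality of [P] along [η X] moves the unit inside, where the triangle identity cancels it
    against the counit. *)
Lemma nu_of_homK P (X : C) :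
  hom_natural P -> nu_of_hom P X ∘ η X = P X X (idc (F X)).
Proof.
move=> N; have := N _ _ _ _ (η X) (idc X) (ε (F X)).
by rewrite fmap_id !comp1c eps_fmap_eta => ->.
Qed.

Lemma semiseparable_unit :
  semiseparable F <->
  exists nu, retraction_natural nu /\ forall X, η X ∘ nu X ∘ η X = η X.
Proof.
split=> [[P [N H]]|[nu [N H]]].
- exists (nu_of_hom P); split; first exact: nu_of_hom_natural.
  (* By naturality, [η X] followed by its image under [P (idc (F X))] is governed by
     [fmap F (P (fmap F (idc X)))], so the hypothesis is used at the identity. *)
  move=> X; rewrite -compA nu_of_homK // -eta_nat -{1}(fmap_id F X) H.
  by rewrite !fmap_id comp1c.
- exists (hom_of_nu nu); split; first exact: hom_of_nu_natural.
  move=> X Y f; apply: adj_inj.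
  by rewrite hom_of_nu_fmap !eta_nat !compA H.
Qed.

Lemma separable_unit :
  separable F <->
  exists nu, retraction_natural nu /\ forall X, nu X ∘ η X = idc X.
Proof.
split=> [[P [N H]]|[nu [N H]]].
- exists (nu_of_hom P); split; first exact: nu_of_hom_natural.
  by move=> X; rewrite nu_of_homK // -(fmap_id F X) H.
- exists (hom_of_nu nu); split; first exact: hom_of_nu_natural.
  by move=> X Y f; rewrite hom_of_nu_fmap H comp1c.
Qed.

Lemma naturally_full_unit :
  naturally_full F <->
  exists nu, retraction_natural nu /\ forall X, η X ∘ nu X = idc (U (F X)).
Proof.
split=> [[P [N H]]|[nu [N H]]].
- exists (nu_of_hom P); split; first exact: nu_of_hom_natural.
  (* Sliding [nu X] past the unit produces [fmap F (P (ε (F X)))], which is [ε (F X)] by fullness;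
     the triangle identity remains. *)
  by move=> X; rewrite -eta_nat H fmap_eps_eta.
- exists (hom_of_nu nu); split; first exact: hom_of_nu_natural.
  move=> X Y h; apply: adj_inj.
  by rewrite eta_nat /hom_of_nu !compA H comp1c.
Qed.

End Rafael.

(** * Transport of regular and split morphisms along isomorphisms *)

Section IsoInvariance.
Variables (C : category) (X X' Y Y' : C) (f : hom X Y) (f' : hom X' Y').
Variables (a : hom X X') (a' : hom X' X) (b : hom Y Y') (b' : hom Y' Y).
Hypotheses (aK : a' ∘ a = idc X) (a'K : a ∘ a' = idc X').
Hypotheses (bK : b' ∘ b = idc Y) (b'K : b ∘ b' = idc Y').
Hypothesis sq : b ∘ f = f' ∘ a.

Let f'E : f' = b ∘ f ∘ a'.
Proof. by rewrite sq -compA a'K compc1. Qed.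

(** Conjugating the inverse [g] to [a ∘ g ∘ b'] works here and in both split cases. *)
Lemma regular_mor_iso : regular_mor f -> regular_mor f'.
Proof.
case=> g H; exists (a ∘ g ∘ b'); rewrite f'E -[in RHS]H !compA.
by rewrite -(compA (b ∘ f) a' a) aK compc1 -(compA _ b' b) bK compc1.
Qed.

Lemma split_mono_iso : split_mono f -> split_mono f'.
Proof.
case=> g H; exists (a ∘ g ∘ b'); rewrite f'E !compA.
by rewrite -(compA _ b' b) bK compc1 -(compA a) H compc1.
Qed.

Lemma split_epi_iso : split_epi f -> split_epi f'.
Proof.
case=> g H; exists (a ∘ g ∘ b'); rewrite f'E !compA.
by rewrite -(compA (b ∘ f) a' a) aK compc1 -(compA b) H compc1.
Qed.

End IsoInvariance.

(** * The free-forgetful adjunctions for right and left modules *)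

Section TensorFunctors.
Variables (C : moncat) (A : algebra C).

Definition rforget : functor (rmod_cat A) C :=
  @Functor (rmod_cat A) C (fun M => rmod M) (fun M N h => rhom_val h)
    (fun _ => eq_refl) (fun _ _ _ _ _ => eq_refl).

Definition lforget : functor (lmod_cat A) C :=
  @Functor (lmod_cat A) C (fun M => lmod M) (fun M N h => lhom_val h)
    (fun _ => eq_refl) (fun _ _ _ _ _ => eq_refl).

Definition reta (X : C) : hom X (X ⊗ A) := (idc X ⊠ aunit A) ∘ runiti X.
Definition leta (X : C) : hom X (A ⊗ X) := (aunit A ⊠ idc X) ∘ luniti X.

Lemma runiti_nat (X Y : C) (f : hom X Y) :
  (f ⊠ idc munit) ∘ runiti X = runiti Y ∘ f.
Proof.
by rewrite -[LHS]comp1c -runitK !compA -(compA (runiti Y)) runit_nat -!compA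
  runitiK compc1.
Qed.

Lemma luniti_nat (X Y : C) (f : hom X Y) :
  (idc munit ⊠ f) ∘ luniti X = luniti Y ∘ f.
Proof.
by rewrite -[LHS]comp1c -lunitK !compA -(compA (luniti Y)) lunit_nat -!compA
  lunitiK compc1.
Qed.

Lemma reta_nat (X Y : C) (f : hom X Y) : (f ⊠ idc A) ∘ reta X = reta Y ∘ f.
Proof. by rewrite /reta compA tmap_lr -compA -runiti_nat compA tmap_rl. Qed.

Lemma leta_nat (X Y : C) (f : hom X Y) : (idc A ⊠ f) ∘ leta X = leta Y ∘ f.
Proof. by rewrite /leta compA tmap_rl -compA -luniti_nat compA tmap_lr. Qed.

(** The counit is the action; its linearity is the associativity axiom read backwards. *)
Definition reps (M : rmod_cat A) : hom (rtensor A (rforget M)) M :=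
  @RHom C A (free_rmod A (rmod M)) M (ract M)
    (eq_sym (eq_trans (ractA M) (eq_sym (compA _ _ _)))).

Lemma lepsP (M : lmod_cat A) :
  lact M ∘ free_lact A (lmod M) = lact M ∘ (idc A ⊠ lact M).
Proof. by rewrite /free_lact compA lactA -compA associK compc1. Qed.

Definition leps (M : lmod_cat A) : hom (ltensor A (lforget M)) M :=
  @LHom C A (free_lmod A (lmod M)) M (lact M) (lepsP M).

(** After sliding the associator past [aunit A], the left unit law of [A] and the triangle axiom
    reduce the composite to [runit] after [runiti]. The left-module version uses the right unit
    law. *)
Lemma free_ract_reta (X : C) :
  free_ract A X ∘ (reta X ⊠ idc A) = idc (X ⊗ A).
Proof.
rewrite /free_ract /reta tmap_compl -compA (compA (assoc _ _ _)) assoc_nat.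
rewrite !compA -tmap_compr amul1l triangle -tmap_compl runitiK.
exact: tmap_id.
Qed.

Lemma free_lact_leta (X : C) :
  free_lact A X ∘ (idc A ⊠ leta X) = idc (A ⊗ X).
Proof.
rewrite /free_lact /leta tmap_compr -compA (compA (associ _ _ _)) associ_nat.
rewrite !compA -tmap_compl amul1r -triangle -(compA _ (assoc _ _ _)) associK.
by rewrite compc1 -tmap_compr lunitiK tmap_id.
Qed.

Definition radj : adjunction (rtensor A) rforget.
Proof.
refine (@Adjunction _ _ (rtensor A) rforget reta reps reta_nat _ _ _).
- by move=> M N h; apply: rhom_eq; apply: rhomP.
- by move=> M; rewrite /= /reta compA ract1 runitiK.
- by move=> X; apply: rhom_eq; apply: free_ract_reta.
Defined.

Definition ladj : adjunction (ltensor A) lforget.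
Proof.
refine (@Adjunction _ _ (ltensor A) lforget leta leps leta_nat _ _ _).
- by move=> M N h; apply: lhom_eq; apply: lhomP.
- by move=> M; rewrite /= /leta compA lact1 lunitiK.
- by move=> X; apply: lhom_eq; apply: free_lact_leta.
Defined.

(** * Natural maps induced by a morphism from the algebra to the unit object *)

Definition rnu (g : hom A munit) (X : C) : hom (X ⊗ A) X :=
  runit X ∘ (idc X ⊠ g).
Definition lnu (g : hom A munit) (X : C) : hom (A ⊗ X) X :=
  lunit X ∘ (g ⊠ idc X).

Lemma rnu_nat g : retraction_natural (F := rtensor A) (U := rforget) (rnu g).
Proof.
by move=> X Y f; rewrite /rnu /= compA -runit_nat -!compA tmap_lr tmap_rl.
Qed.

Lemma lnu_nat g : retraction_natural (F := ltensor A) (U := lforget) (lnu g).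
Proof.
by move=> X Y f; rewrite /lnu /= compA -lunit_nat -!compA tmap_lr tmap_rl.
Qed.

(** This and the next three lemmas transfer equations on [g ∘ aunit A] and [aunit A ∘ g] to [nu] and
    the unit of the adjunction. *)
Lemma rnu_reta g X :
  rnu g X ∘ reta X = runit X ∘ (idc X ⊠ (g ∘ aunit A)) ∘ runiti X.
Proof. by rewrite /rnu /reta tmap_compr !compA. Qed.

Lemma lnu_leta g X :
  lnu g X ∘ leta X = lunit X ∘ ((g ∘ aunit A) ⊠ idc X) ∘ luniti X.
Proof. by rewrite /lnu /leta tmap_compl !compA. Qed.

Lemma reta_rnu g X : reta X ∘ rnu g X = idc X ⊠ (aunit A ∘ g).
Proof.
by rewrite /rnu /reta tmap_compr !compA -(compA _ (runiti X)) runitK compc1.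
Qed.

Lemma leta_lnu g X : leta X ∘ lnu g X = (aunit A ∘ g) ⊠ idc X.
Proof.
by rewrite /lnu /leta tmap_compl !compA -(compA _ (luniti X)) lunitK compc1.
Qed.

Lemma lunit_runitK :
  (runit munit ∘ luniti munit) ∘ (lunit munit ∘ runiti munit)
  = idc (munit (m := C)).
Proof.
by rewrite -compA (compA (luniti _)) lunitK comp1c runitiK.
Qed.

Lemma runit_lunitK :
  (lunit munit ∘ runiti munit) ∘ (runit munit ∘ luniti munit)
  = idc (munit (m := C)).
Proof.
by rewrite -compA (compA (runiti _)) runitK comp1c lunitiK.
Qed.

(** At [munit] the unit of the adjunction tensors [aunit A] with [munit] on the left, so naturality
    of the left unitor straightens it; this is the square for the transport lemmas. *)
Lemma reta_aunit :
  lunit A ∘ reta munit = aunit A ∘ (lunit munit ∘ runiti munit).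
Proof. by rewrite /reta compA lunit_nat -compA. Qed.

Lemma leta_aunit :
  runit A ∘ leta munit = aunit A ∘ (runit munit ∘ luniti munit).
Proof. by rewrite /leta compA runit_nat -compA. Qed.

(** * The six equivalences *)

Lemma regular_rtensor : regular_mor (aunit A) <-> semiseparable (rtensor A).
Proof.
apply: (iff_trans _ (iff_sym (semiseparable_unit radj))); split=> [[g H]|[nu [_ H]]].
- exists (rnu g); split; first exact: rnu_nat.
  (* The composite is [idc X] tensored with [aunit A ∘ g ∘ aunit A], up to [runiti X]. *)
  by move=> X; rewrite reta_rnu /reta compA -tmap_compr H.
- apply: (regular_mor_iso lunit_runitK runit_lunitK (lunitK A)
    reta_aunit).
  by exists (nu munit); apply: H.
Qed.

Lemma regular_ltensor : regular_mor (aunit A) <-> semiseparable (ltensor A).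
Proof.
apply: (iff_trans _ (iff_sym (semiseparable_unit ladj))); split=> [[g H]|[nu [_ H]]].
- exists (lnu g); split; first exact: lnu_nat.
  by move=> X; rewrite leta_lnu /leta compA -tmap_compl H.
- apply: (regular_mor_iso runit_lunitK lunit_runitK (runitK A)
    leta_aunit).
  by exists (nu munit); apply: H.
Qed.

Lemma split_mono_rtensor : split_mono (aunit A) <-> separable (rtensor A).
Proof.
apply: (iff_trans _ (iff_sym (separable_unit radj))); split=> [[g H]|[nu [_ H]]].
- exists (rnu g); split; first exact: rnu_nat.
  by move=> X; rewrite rnu_reta H tmap_id compc1 runitiK.
- apply: (split_mono_iso runit_lunitK (lunitK A) reta_aunit).
  by exists (nu munit); apply: H.
Qed.

Lemma split_mono_ltensor : split_mono (aunit A) <-> separable (ltensor A).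
Proof.
apply: (iff_trans _ (iff_sym (separable_unit ladj))); split=> [[g H]|[nu [_ H]]].
- exists (lnu g); split; first exact: lnu_nat.
  by move=> X; rewrite lnu_leta H tmap_id compc1 lunitiK.
- apply: (split_mono_iso lunit_runitK (runitK A) leta_aunit).
  by exists (nu munit); apply: H.
Qed.

Lemma split_epi_rtensor : split_epi (aunit A) <-> naturally_full (rtensor A).
Proof.
apply: (iff_trans _ (iff_sym (naturally_full_unit radj))); split=> [[g H]|[nu [_ H]]].
- exists (rnu g); split; first exact: rnu_nat.
  by move=> X; rewrite reta_rnu H tmap_id.
- apply: (split_epi_iso lunit_runitK runit_lunitK (lunitiK A)
    reta_aunit).
  by exists (nu munit); apply: H.
Qed.

Lemma split_epi_ltensor : split_epi (aunit A) <-> naturally_full (ltensor A).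
Proof.
apply: (iff_trans _ (iff_sym (naturally_full_unit ladj))); split=> [[g H]|[nu [_ H]]].
- exists (lnu g); split; first exact: lnu_nat.
  by move=> X; rewrite leta_lnu H tmap_id.
- apply: (split_epi_iso runit_lunitK lunit_runitK (runitiK A)
    leta_aunit).
  by exists (nu munit); apply: H.
Qed.

End TensorFunctors.

Theorem proposition3p20 (C : moncat) (A : algebra C) :
  ((regular_mor (aunit A) <-> semiseparable (rtensor A)) /\
   (regular_mor (aunit A) <-> semiseparable (ltensor A))) /\
  ((split_mono (aunit A) <-> separable (rtensor A)) /\
   (split_mono (aunit A) <-> separable (ltensor A))) /\
  ((split_epi (aunit A) <-> naturally_full (rtensor A)) /\
   (split_epi (aunit A) <-> naturally_full (ltensor A))).
Proof.
split; [|split]; split.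
- exact: regular_rtensor.
- exact: regular_ltensor.
- exact: split_mono_rtensor.
- exact: split_mono_ltensor.
- exact: split_epi_rtensor.
- exact: split_epi_ltensor.
Qed.
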